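(* Let $n\ge 3$ and let $A$ be a commutative ring. The assignment $y_\alpha^a\mapsto x_\alpha^a\, y_\alpha$ ($\alpha\in\Delta$, $a\in A$) induces a group isomorphism $$\phi: Br(D_n,A)\longrightarrow St(D_n,A)\rtimes Br(D_n).$$
   Context: The root system $D_n$ consists of the vectors $\pm\epsilon_i\pm\epsilon_j$ ($1\le i\ne j\le n$) in $\mathbb R^n$. Fix the simple system $\Delta=\{\alpha_2,\alpha_{2'},\alpha_3,\dots,\alpha_n\}$ with $\alpha_i=-\epsilon_{i-1}+\epsilon_i$ ($2\le i\le n$) and $\alpha_{2'}=\epsilon_1+\epsilon_2$. Two simple roots are adjacent (in the Dynkin diagram) exactly for the pairs $\{\alpha_2,\alpha_3\}$, $\{\alpha_{2'},\alpha_3\}$, $\{\alpha_k,\alpha_{k+1}\}$ ($3\le k\le n-1$); these are ordered by $\alpha_2<\alpha_3<\dots<\alpha_n$ and $\alpha_{2'}<\alpha_3$. $Br(D_n,A)$ is the group generated by $y_\alpha^a$, $\alpha\in\Delta$, $a\in A$, with relations for $a,b,c\in A$: (A1) $y_\alpha^a y_\alpha^0 y_\alpha^b = y_\alpha^0 y_\alpha^0 y_\alpha^{a+b}$; (A1$\times$A1) $y_\alpha^a y_\beta^b=y_\beta^b y_\alpha^a$ if $\alpha\ne\beta$ are not adjacent; (A2) $y_\alpha^a y_\beta^b y_\alpha^c = y_\beta^c y_\alpha^{b+ac} y_\beta^a$ if $\alpha,\beta$ are adjacent and $\alpha<\beta$. $Br(D_n)=Br(D_n,0)$ is the braid group with generators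 $y_\alpha$ ($\alpha\in\Delta$), relations $y_\alpha y_\beta=y_\beta y_\alpha$ for non-adjacent $\alpha\neq\beta$ and $y_\alpha y_\beta y_\alpha=y_\beta y_\alpha y_\beta$ for adjacent ones; it maps onto the Weyl group $W(D_n)$ by $y_\alpha\mapsto\sigma_\alpha$ (the reflection in $\alpha$). $St(D_n,A)$ is generated by $x_\alpha^a$, $\alpha\in D_n$, $a\in A$, with relations: $x_\alpha^a x_\alpha^b=x_\alpha^{a+b}$; $x_\alpha^a x_\beta^b = x_\beta^b x_\alpha^a$ if $\alpha+\beta\notin D_n$ and $\alpha+\beta\ne0$; $x_\alpha^a x_\beta^b = x_\beta^b x_{\alpha+\beta}^{ab} x_\alpha^a$ if $\alpha+\beta\in D_n$. $W(D_n)$, hence $Br(D_n)$, acts on $St(D_n,A)$ by $\sigma\cdot x_\alpha^a = x_{\sigma(\alpha)}^a$, and the semidirect product is taken for this action. *)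

(* Defs.v *)
From HB Require Import structures.
From mathcomp Require Import all_boot all_order all_algebra.
Set Implicit Arguments. Unset Strict Implicit. Unset Printing Implicit Defensive.
Import GRing.Theory.
Local Open Scope ring_scope.

(* Groups given by generators and relations, as setoids of words.       *)
(* A letter is (b, g): b = false is g, b = true is g^{-1}.               *)
(* peqv R is the congruence on words generated by free cancellation and  *)
(* the defining relations R; the presented group is word G / peqv R.     *)
Definition word (G : Type) := seq (bool * G).
Definition gen (G : Type) (g : G) : bool * G := (false, g).
Definition winv (G : Type) (w : word G) : word G :=
  rev (map (fun l => (~~ l.1, l.2)) w).

Inductive peqv (G : Type) (R : word G -> word G -> Prop) : word G -> word G -> Prop :=
| peqv_refl w : peqv R w w
| peqv_sym w1 w2 : peqv R w1 w2 -> peqv R w2 w1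
| peqv_trans w1 w2 w3 : peqv R w1 w2 -> peqv R w2 w3 -> peqv R w1 w3
| peqv_cancel (u v : word G) b g : peqv R (u ++ (b, g) :: (~~ b, g) :: v) (u ++ v)
| peqv_rel (u v l1 l2 : word G) : R l1 l2 -> peqv R (u ++ l1 ++ v) (u ++ l2 ++ v).

(* The root system D_n in Z^n (coordinates indexed by 'I_n, 0-based:    *)
(* paper's eps_{k+1} is our eps_nat n k).                               *)
Notation vec n := {ffun 'I_n -> int}.
Definition vzero n : vec n := [ffun => 0].
Definition vadd n (u v : vec n) : vec n := [ffun k => u k + v k].
Definition vscale n (c : int) (u : vec n) : vec n := [ffun k => c * u k].
Definition vdot n (u v : vec n) : int := \sum_k u k * v k.
Definition eps n (i : 'I_n) : vec n := [ffun k : 'I_n => ((k == i) : nat)%:Z].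
Definition eps_nat n (i : nat) : vec n := [ffun k : 'I_n => (((k : nat) == i) : nat)%:Z].
Definition sgb (s : bool) : int := if s then -1 else 1.

Definition is_root n (v : vec n) : bool :=
  [exists i : 'I_n, exists j : 'I_n, (i != j) &&
     [exists s : bool, exists t : bool,
        v == vadd (vscale (sgb s) (eps i)) (vscale (sgb t) (eps j))]].

Definition droot n := {v : vec n | is_root v}.

(* reflection sigma_a(v) = v - (v.a) a  (a.a = 2 for roots) *)
Definition vrefl n (a v : vec n) : vec n := vadd v (vscale (- vdot v a) a).
(* on roots (reflections in roots preserve D_n; insubd default never used) *)
Definition rrefl n (a : vec n) (r : droot n) : droot n := insubd r (vrefl a (val r)).

(* Simple system Delta, indexed by 'I_n:                                *)
(*   index 0      <-> alpha_{2'} = eps_1 + eps_2                        *)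
(*   index k >= 1 <-> alpha_{k+1} = - eps_k + eps_{k+1}                 *)
Definition simple_vec n (i : 'I_n) : vec n :=
  if (i : nat) == 0%N then vadd (eps_nat n 0) (eps_nat n 1)
  else vadd (vscale (-1) (eps_nat n i.-1)) (eps_nat n i).

(* adjacency: {alpha_2,alpha_3} = {1,2}; {alpha_2',alpha_3} = {0,2};
   {alpha_k,alpha_(k+1)}, 3 <= k <= n-1  = {j,j+1}, 2 <= j <= n-2 *)
Definition sadj n (i j : 'I_n) : bool :=
  let p := (i : nat) in let q := (j : nat) in
  [|| [&& p == 1%N & q == 2%N], [&& p == 2%N & q == 1%N],
      [&& p == 0%N & q == 2%N], [&& p == 2%N & q == 0%N],
      [&& 2 <= p, q == p.+1 & true]%N | [&& 2 <= q, p == q.+1 & true]%N ].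

(* the paper's order: alpha_2 < alpha_3 < ... < alpha_n, alpha_2' < alpha_3
   (alpha_2 and alpha_2' incomparable) *)
Definition slt n (i j : 'I_n) : bool :=
  ((i < j)%N && ~~ (((i : nat) == 0%N) && ((j : nat) == 1%N))).

Inductive BrA_rel n (A : comPzRingType) : word ('I_n * A) -> word ('I_n * A) -> Prop :=
| BrA_A1 (i : 'I_n) (a b : A) :
    BrA_rel [:: gen (i, a); gen (i, 0); gen (i, b)]
            [:: gen (i, 0); gen (i, 0); gen (i, a + b)]
| BrA_A1A1 (i j : 'I_n) (a b : A) : i != j -> ~~ sadj i j ->
    BrA_rel [:: gen (i, a); gen (j, b)] [:: gen (j, b); gen (i, a)]
| BrA_A2 (i j : 'I_n) (a b c : A) : sadj i j -> slt i j ->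
    BrA_rel [:: gen (i, a); gen (j, b); gen (i, c)]
            [:: gen (j, c); gen (i, b + a * c); gen (j, a)].

Inductive Br_rel n : word 'I_n -> word 'I_n -> Prop :=
| Br_comm (i j : 'I_n) : i != j -> ~~ sadj i j ->
    Br_rel [:: gen i; gen j] [:: gen j; gen i]
| Br_braid (i j : 'I_n) : sadj i j ->
    Br_rel [:: gen i; gen j; gen i] [:: gen j; gen i; gen j].

Inductive St_rel n (A : comPzRingType) : word (droot n * A) -> word (droot n * A) -> Prop :=
| St_add (al : droot n) (a b : A) :
    St_rel [:: gen (al, a); gen (al, b)] [:: gen (al, a + b)]
| St_comm (al be : droot n) (a b : A) :
    ~~ is_root (vadd (val al) (val be)) -> vadd (val al) (val be) != vzero n ->
    St_rel [:: gen (al, a); gen (be, b)] [:: gen (be, b); gen (al, a)]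
| St_chev (al be ga : droot n) (a b : A) :
    val ga = vadd (val al) (val be) ->
    St_rel [:: gen (al, a); gen (be, b)]
           [:: gen (be, b); gen (ga, a * b); gen (al, a)].

(* Action of Br(D_n) on St(D_n,A) through W(D_n), and the semidirect     *)
(* product St(D_n,A) x| Br(D_n), with elements pairs (s, b) and product  *)
(* (s, b)(s', b') = (s (b . s'), b b').                                 *)
Definition act_root n (w : word 'I_n) (r : droot n) : droot n :=
  foldr (fun l r' => rrefl (simple_vec l.2) r') r w.

Definition act_st n (A : comPzRingType) (w : word 'I_n) (s : word (droot n * A))
  : word (droot n * A) :=
  map (fun l => (l.1, (act_root w l.2.1, l.2.2))) s.

Definition sd_mul n (A : comPzRingType) (p q : word (droot n * A) * word 'I_n)
  : word (droot n * A) * word 'I_n :=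
  (p.1 ++ act_st p.2 q.1, p.2 ++ q.2).

Definition sd_inv n (A : comPzRingType) (p : word (droot n * A) * word 'I_n)
  : word (droot n * A) * word 'I_n :=
  (act_st (winv p.2) (winv p.1), winv p.2).

(* image of y_alpha^a : x_alpha^a y_alpha  (insub never fails for n >= 2) *)
Definition phi_gen n (A : comPzRingType) (i : 'I_n) (a : A)
  : word (droot n * A) * word 'I_n :=
  (match insub (simple_vec i) with
   | Some r => [:: gen (r, a)]
   | None => [::]
   end, [:: gen i]).

Definition phi_letter n (A : comPzRingType) (l : bool * ('I_n * A))
  : word (droot n * A) * word 'I_n :=
  if l.1 then sd_inv (phi_gen l.2.1 l.2.2) else phi_gen l.2.1 l.2.2.

Definition phi n (A : comPzRingType) (w : word ('I_n * A))
  : word (droot n * A) * word 'I_n :=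
  foldr (fun l acc => sd_mul (phi_letter l) acc) ([::], [::]) w.

(* Main.v *)
(* The elements [x_i^a := y_i^a (y_i^0)^-1] of [Br(D_n,A)] are carried along the
   root system by conjugation with the [y_k^0].  That the result depends only on
   the root reached is proved by induction on the height, using nothing about
   [D_n] except that it is simply laced: two descents from a positive root [v]
   through simple roots [k], [l] with [<v,k> = <v,l> = 1] are compared by the
   commutation or braid relation, the only exceptional case being
   [v = alpha_k + alpha_l], which is an instance of (A2).  This yields elements
   [x_v^a] for all roots, permuted by conjugation as the roots are by the Weyl
   group.  Every Steinberg relation is then conjugate to one between [alpha_2] or
   [alpha_{2'}] and [alpha_3] (where it is (A2)) or between orthogonal simple
   roots, since W(D_n) moves three signed coordinates to the first three with at
   most one sign left over, and four likewise.  The resulting map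
   [(s, b) |-> s b] is a left inverse of [phi].

   Because the Chevalley relation of [St] holds for both orders of the two roots
   and W(D_n) acts without signs, [x_v^(2a) = 1] on both sides. *)
From HB Require Import structures.
From mathcomp Require Import all_boot all_algebra boolp.
From mathcomp Require Import generic_quotient.
From mathcomp Require Import perm.
From mathcomp Require Import ring zify.
Require Import Defs.
Set Implicit Arguments. Unset Strict Implicit. Unset Printing Implicit Defensive.
Import GRing.Theory.
Local Open Scope ring_scope.

(** * Presented groups *)

Lemma winv_cat (G : Type) (u v : word G) : winv (u ++ v) = winv v ++ winv u.
Proof. by rewrite /winv map_cat rev_cat. Qed.

Section PresentedGroup.
Variables (G : choiceType) (R : word G -> word G -> Prop).
Local Open Scope quotient_scope.

Lemma peqv_ctx (x y u v : word G) :
  peqv R u v -> peqv R (x ++ u ++ y) (x ++ v ++ y).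
Proof.
elim=> {u v} [w|u v _ /peqv_sym //|u v w _ uv _ vw|u v b g|u v l1 l2 Rl].
- exact: peqv_refl.
- exact: peqv_trans uv vw.
- by rewrite -!catA !cat_cons !(catA x u); apply: peqv_cancel.
- by rewrite -!catA !(catA x u); apply: peqv_rel.
Qed.

Lemma peqv_cat (u u' v v' : word G) :
  peqv R u u' -> peqv R v v' -> peqv R (u ++ v) (u' ++ v').
Proof.
move=> uu' vv'; apply: (@peqv_trans _ _ _ (u' ++ v)).
  exact: (peqv_ctx [::] v uu').
by have := peqv_ctx u' [::] vv'; rewrite !cats0.
Qed.

Lemma winvK : involutive (@winv G).
Proof.
move=> w; rewrite /winv map_rev revK -map_comp -[RHS]map_id.
by apply: eq_map => -[b g] /=; rewrite negbK.
Qed.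

Lemma peqv_mulwV (w : word G) : peqv R (w ++ winv w) [::].
Proof.
elim: w => [|[b g] w IH]; first exact: peqv_refl.
rewrite -[(b, g) :: w]cat1s winv_cat catA -catA -catA.
apply: peqv_trans (peqv_cancel R [::] [::] b g).
have := peqv_ctx [:: (b, g)] (winv [:: (b, g)]) IH.
by rewrite -!catA.
Qed.

Lemma peqv_mulVw (w : word G) : peqv R (winv w ++ w) [::].
Proof. by have := peqv_mulwV (winv w); rewrite winvK. Qed.

Lemma peqv_winv (u v : word G) : peqv R u v -> peqv R (winv u) (winv v).
Proof.
move=> uv; have /peqv_sym h := peqv_cat (peqv_refl R (winv u)) (peqv_mulwV v).
rewrite cats0 in h; apply: (peqv_trans h); rewrite catA.
apply: (peqv_cat (v' := winv v) (u' := [::])); last exact: peqv_refl.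
apply: peqv_trans (peqv_mulVw u).
exact: peqv_cat (peqv_refl R _) (peqv_sym uv).
Qed.

(** The generic quotient asks for a boolean relation. The congruence need not be decidable, so it is
    made boolean classically. *)
Definition peqvb (u v : word G) : bool := `[< peqv R u v >].

Lemma peqvb_refl : reflexive peqvb.
Proof. by move=> w; apply/asboolP/peqv_refl. Qed.
Lemma peqvb_sym : symmetric peqvb.
Proof. by move=> u v; apply/asboolP/asboolP => /peqv_sym. Qed.
Lemma peqvb_trans : transitive peqvb.
Proof. by move=> v u w /asboolP uv /asboolP vw; apply/asboolP/(peqv_trans uv). Qed.

Canonical peqv_equiv := EquivRel peqvb peqvb_refl peqvb_sym peqvb_trans.

Definition pgroup := {eq_quot peqvb}.
HB.instance Definition _ := Choice.on pgroup.

Definition cls (w : word G) : pgroup := \pi_({eq_quot peqvb}) w.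

Lemma clsP (u v : word G) : cls u = cls v <-> peqv R u v.
Proof.
split=> [/eqP|uv]; first by rewrite /cls eqmodE => /asboolP.
by apply/eqP; rewrite /cls eqmodE; apply/asboolP.
Qed.

Lemma cls_ind (P : pgroup -> Prop) : (forall w, P (cls w)) -> forall x, P x.
Proof. by move=> Pc x; rewrite -[x]reprK; apply: Pc. Qed.

Let repr_cls (w : word G) : peqv R (repr (cls w)) w.
Proof. by apply/clsP; rewrite /cls reprK. Qed.

Definition pg_mul (x y : pgroup) : pgroup := cls (repr x ++ repr y).
Definition pg_inv (x : pgroup) : pgroup := cls (winv (repr x)).

Let mulE u v : pg_mul (cls u) (cls v) = cls (u ++ v).
Proof. by apply/clsP/peqv_cat; apply: repr_cls. Qed.
Let invE u : pg_inv (cls u) = cls (winv u).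
Proof. by apply/clsP/peqv_winv/repr_cls. Qed.

Lemma pg_mulA : associative pg_mul.
Proof.
elim/cls_ind=> u; elim/cls_ind=> v; elim/cls_ind=> w.
by rewrite !mulE catA.
Qed.
Lemma pg_mul1 : left_id (cls [::]) pg_mul.
Proof. by elim/cls_ind=> u; rewrite mulE. Qed.
Lemma pg_mulr1 : right_id (cls [::]) pg_mul.
Proof. by elim/cls_ind=> u; rewrite mulE cats0. Qed.
Lemma pg_mulV : left_inverse (cls [::]) pg_inv pg_mul.
Proof. by elim/cls_ind=> u; rewrite invE mulE; apply/clsP/peqv_mulVw. Qed.
Lemma pg_mulrV : right_inverse (cls [::]) pg_inv pg_mul.
Proof. by elim/cls_ind=> u; rewrite invE mulE; apply/clsP/peqv_mulwV. Qed.

HB.instance Definition _ := isGroup.Build pgroup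
  pg_mulA pg_mul1 pg_mulr1 pg_mulV pg_mulrV.

Lemma cls_nil : cls [::] = 1%g. Proof. by []. Qed.
Lemma cls_cat u v : cls (u ++ v) = (cls u * cls v)%g.
Proof. by rewrite -mulE. Qed.
Lemma cls_winv u : cls (winv u) = (cls u)^-1%g.
Proof. by rewrite -invE. Qed.

Definition pgen (g : G) : pgroup := cls [:: gen g].

Lemma cls_cons (l : bool * G) (w : word G) :
  cls (l :: w) = ((if l.1 then (pgen l.2)^-1 else pgen l.2) * cls w)%g.
Proof. by rewrite -cat1s cls_cat; case: l => [[] g] //=; rewrite -cls_winv. Qed.

Lemma cls_rel l1 l2 : R l1 l2 -> cls l1 = cls l2.
Proof.
by move=> Rl; apply/clsP; have := peqv_rel [::] [::] Rl; rewrite !cats0.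
Qed.

End PresentedGroup.
Arguments pgen {G} R g.
Arguments cls {G} R w.

(** * Homomorphisms out of a presented group *)

Section Evaluation.
Variables (G : Type) (H : groupType) (f : G -> H).
Local Open Scope group_scope.

Definition eval_letter (l : bool * G) : H :=
  if l.1 then (f l.2)^-1 else f l.2.
Definition eval (w : word G) : H := foldr (fun l h => eval_letter l * h) 1 w.

Lemma eval_cat u v : eval (u ++ v) = eval u * eval v.
Proof. by elim: u => [|l u IH] /=; rewrite ?mul1g // IH mulgA. Qed.

Lemma eval_winv w : eval (winv w) = (eval w)^-1.
Proof.
elim: w => [|[b g] w IH]; first by rewrite invg1.
rewrite -cat1s winv_cat !eval_cat invgM IH; congr (_ * _).
by rewrite /= !mulg1 /eval_letter /=; case: b; rewrite ?invgK.
Qed.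

(** The universal property of the presentation: a map of generators that respects the relations is
    constant on classes of words. *)
Lemma eval_peqv (R : word G -> word G -> Prop) :
  (forall l1 l2, R l1 l2 -> eval l1 = eval l2) ->
  forall u v, peqv R u v -> eval u = eval v.
Proof.
move=> Rf u v.
elim=> {u v} [//|u v _ -> //|u v w _ -> _ -> //|u v b g|u v l1 l2 /Rf E].
  rewrite !eval_cat /= /eval_letter /= mulgA.
  by case: b; rewrite /= ?mulgK ?mulgVK -?mulgA ?mulKg ?mulVKg.
by rewrite !eval_cat E.
Qed.

End Evaluation.

Lemma eval_pgen (G : choiceType) (R : word G -> word G -> Prop) w :
  eval (pgen R) w = cls R w.
Proof. by elim: w => [|l w IH] //=; rewrite cls_cons IH. Qed.

(** * Lifting a simple system along reflections *)

Section Vectors.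
Variable n : nat.
Implicit Types a b u v w : vec n.

Lemma vaddE u v : vadd u v = u + v. Proof. by []. Qed.
Lemma vzeroE : vzero n = 0. Proof. by []. Qed.

Lemma vdotC u v : vdot u v = vdot v u.
Proof. by apply: eq_bigr => k _; rewrite mulrC. Qed.

Lemma vdotDl u v w : vdot (u + v) w = vdot u w + vdot v w.
Proof. by rewrite -big_split; apply: eq_bigr => k _; rewrite ffunE mulrDl. Qed.

Lemma vdotNl u w : vdot (- u) w = - vdot u w.
Proof. by rewrite -sumrN; apply: eq_bigr => k _; rewrite ffunE mulNr. Qed.

Lemma vdotZl x u w : vdot (vscale x u) w = x * vdot u w.
Proof. by rewrite mulr_sumr; apply: eq_bigr => k _; rewrite ffunE mulrA. Qed.

Lemma vdotDr u v w : vdot w (u + v) = vdot w u + vdot w v.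
Proof. by rewrite !(vdotC w) vdotDl. Qed.

Lemma vdotNr u w : vdot w (- u) = - vdot w u.
Proof. by rewrite !(vdotC w) vdotNl. Qed.

Lemma vdotZr x u w : vdot w (vscale x u) = x * vdot w u.
Proof. by rewrite !(vdotC w) vdotZl. Qed.

Definition vdotE := (vdotDl, vdotDr, vdotNl, vdotNr, vdotZl, vdotZr).

Lemma vdot_ge0 u : 0 <= vdot u u.
Proof. by apply: Num.Theory.sumr_ge0 => k _; apply: Num.Theory.sqr_ge0. Qed.

Lemma vdot_eq0 u : vdot u u = 0 -> u = 0.
Proof.
move/eqP; rewrite Num.Theory.psumr_eq0 => [/allP u0|k _]; last first.
  exact: Num.Theory.sqr_ge0.
apply/ffunP => k; rewrite ffunE; apply/eqP.
by have := u0 k (mem_index_enum k); rewrite mulf_eq0 orbb.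
Qed.

Lemma vreflE a v : vrefl a v = v + vscale (- vdot v a) a. Proof. by []. Qed.

Lemma vreflD a u v : vrefl a (u + v) = vrefl a u + vrefl a v.
Proof. by apply/ffunP => k; rewrite !ffunE vdotDl; ring. Qed.

Lemma vreflN a u : vrefl a (- u) = - vrefl a u.
Proof. by apply/ffunP => k; rewrite !ffunE vdotNl; ring. Qed.

Lemma vreflK a : vdot a a = 2 -> involutive (vrefl a).
Proof. by move=> a2 v; apply/ffunP => k; rewrite !ffunE !vdotE a2; ring. Qed.

Lemma vrefl_comm a b v : vdot a b = 0 ->
  vrefl a (vrefl b v) = vrefl b (vrefl a v).
Proof.
move=> ab; have ba : vdot b a = 0 by rewrite vdotC.
by apply/ffunP => k; rewrite !ffunE !vdotE ab ba; ring.
Qed.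

Lemma vrefl_braid a b v : vdot a a = 2 -> vdot b b = 2 -> vdot a b = -1 ->
  vrefl a (vrefl b (vrefl a v)) = vrefl b (vrefl a (vrefl b v)).
Proof.
move=> a2 b2 ab; have ba : vdot b a = -1 by rewrite vdotC.
by apply/ffunP => k; rewrite !ffunE !vdotE ab ba a2 b2; ring.
Qed.

End Vectors.

(** * Transport of values from simple roots to all roots, simply laced case *)

Section RootLift.
Variables (n : nat) (I : eqType) (adj : rel I) (al : I -> vec n) (rho : vec n).
Hypothesis adj_sym : symmetric adj.
Hypothesis al2 : forall i, vdot (al i) (al i) = 2.
Hypothesis al_adj : forall i j, adj i j -> vdot (al i) (al j) = -1.
Hypothesis al_nadj : forall i j, i != j -> ~~ adj i j -> vdot (al i) (al j) = 0.
Hypothesis al_rho : forall i, vdot (al i) rho = 1.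
Variables (Z : Type) (c : I -> Z -> Z).
Hypothesis c_comm : forall i j z, i != j -> ~~ adj i j ->
  c i (c j z) = c j (c i z).
Hypothesis c_braid : forall i j z, adj i j ->
  c i (c j (c i z)) = c j (c i (c j z)).

(** These are the constraints on the values [X] at simple roots coming from rank two: stability
    under an orthogonal reflection, agreement of the two ways to reach [al i + al j], and trivial
    action of a squared generator. *)
Definition compatible (X : I -> Z) :=
  [/\ forall i j, i != j -> ~~ adj i j -> c i (X j) = X j,
      forall i j, adj i j -> c i (X j) = c j (X i)
    & forall i j, adj i j -> c i (c i (X j)) = X j].

(** A relation rather than a function, because a root can be reached by several ascending chains;
    [lift_uniq] removes the dependence on the chain. The index is the height minus one. *)
Inductive lift (X : I -> Z) : nat -> vec n -> Z -> Prop :=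
| lift_simple i : lift X 0 (al i) (X i)
| lift_up m v z k : vdot v (al k) = -1 -> lift X m v z ->
    lift X m.+1 (v + al k) (c k z).

Lemma al_inj : injective al.
Proof.
move=> i j E; apply/eqP; apply: contraT => ij.
have := al2 i; rewrite {2}E.
by have [/al_adj ->|/(al_nadj ij) ->] := boolP (adj i j).
Qed.

(** The equality case of Cauchy-Schwarz: [u - v] has norm [2 + 2 - 4]. *)
Lemma norm2_eq (u v : vec n) :
  vdot u u = 2 -> vdot v v = 2 -> vdot u v = 2 -> u = v.
Proof.
move=> u2 v2 uv; apply/eqP; rewrite -subr_eq0; apply/eqP/vdot_eq0.
by rewrite !vdotE u2 v2 (vdotC v u) uv.
Qed.

Section Compatible.
Variable X : I -> Z.
Hypothesis compX : compatible X.
Local Notation lift := (lift X).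

Lemma lift_norm m v z : lift m v z -> vdot v v = 2.
Proof.
elim=> [i|{}m {}v {}z k vk _ v2]; first exact: al2.
by rewrite !vdotE (vdotC (al k)) al2 v2 vk.
Qed.

Lemma lift_ht m v z : lift m v z -> vdot v rho = m.+1%:Z.
Proof.
elim=> [i|{}m {}v {}z k vk _ h]; first exact: al_rho.
by rewrite vdotDl h al_rho; lia.
Qed.

Lemma lift_al_inv m v z i : lift m v z -> v = al i -> m = 0%N /\ z = X i.
Proof.
case=> [j /al_inj -> //|{}m {}v {}z k _ /lift_ht h E].
by have := al_rho i; rewrite -E vdotDl h al_rho; lia.
Qed.

(** Any simple root that can be subtracted may be taken as the last step of the chain. If it is
    orthogonal to the actual last step, the two steps are exchanged by [c_comm]. *)
Lemma lift_down m v z k : lift m v z -> vdot v (al k) = 1 ->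
  exists m' z', [/\ m = m'.+1, lift m' (v - al k) z' & z = c k z'].
Proof.
case: compX => _ Xadj _.
move=> L; elim: L k => [i k|{}m {}v {}z l vl L IH k].
  have [->|ik] := eqVneq i k; first by rewrite al2.
  by have [/al_adj ->|/(al_nadj ik) ->] := boolP (adj i k).
have [<-{k} _|lk] := eqVneq l k; first by exists m, z; rewrite addrK.
have [adjlk|nadj] := boolP (adj l k); rewrite vdotDl.
  rewrite (al_adj adjlk) => h.
  (* With [l] and [k] adjacent, [v] pairs to 2 with [al k], so the root is [al k + al l] and
     compatibility of [X] concludes. *)
  have E : v = al k by apply: norm2_eq (lift_norm L) (al2 k) _; lia.
  have [-> ->] := lift_al_inv L E.
  exists 0%N, (X l); split=> //; last exact: Xadj.
  by rewrite E addrC addKr; apply: lift_simple.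
rewrite (al_nadj lk nadj) addr0 => /IH[m' [z' [-> L' ->]]].
exists m'.+1, (c l z'); split=> //; last exact: c_comm.
rewrite addrAC; apply: lift_up L'.
by rewrite !vdotE vl vdotC (al_nadj lk nadj) subr0.
Qed.

Lemma lift_uniq m v z m' z' : lift m v z -> lift m' v z' -> z = z'.
Proof.
move=> L; elim: L m' z' => [i m' z' L'|{}m {}v {}z k vk _ IH m' z' L'].
  by have [_ ->] := lift_al_inv L' erefl.
have [|m1 [z1 [_ L1 ->]]] := lift_down (k := k) L'.
  by rewrite vdotDl vk al2.
by rewrite addrK in L1; rewrite (IH _ _ L1).
Qed.

(** Strong induction is used because the adjacent case goes down by two steps: the chain ends with
    [k], then [l], and the braid relation turns the claim into [c l] fixing the value below both, a
    root orthogonal to [al l]. *)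
Lemma lift_fix m v z k : lift m v z -> vdot v (al k) = 0 -> c k z = z.
Proof.
case: compX => Xnadj _ _.
elim/ltn_ind: m v z k => m IH v z k L; case: L IH => [i|{}m {}v {}z l vl L] IH.
  have [->|ik] := eqVneq i k; first by rewrite al2.
  have [/al_adj ->//|nadj _] := boolP (adj i k).
  by apply: Xnadj; rewrite 1?eq_sym // adj_sym.
have [<-|lk] := eqVneq l k; first by rewrite vdotDl vl al2.
have [adjlk|nadj] := boolP (adj l k); rewrite vdotDl.
  rewrite (al_adj adjlk) => h.
  have [|m' [z' [Em L' ->]]] := lift_down (k := k) L; first lia.
  rewrite c_braid 1?adj_sym //; do 2!congr (c _ _).
  by apply: IH L' _; rewrite ?Em // !vdotE vl vdotC al_adj.
rewrite (al_nadj lk nadj) addr0 => /(IH _ (ltnSn m) _ _ _ L) E.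
by rewrite -c_comm // E.
Qed.

(** If the last step [l] is adjacent to [k], the previous root is orthogonal to [al k]. Its value
    [z] equals [c k z], and two braid moves turn [c k (c k (c l (c k z)))] into
    [c l (c k (c l (c l z)))], where induction applies. *)
Lemma lift_sqr m v z k : lift m v z -> vdot v (al k) = -1 -> c k (c k z) = z.
Proof.
case: compX => _ _ Xsqr.
move=> L; elim: L k => [i k|{}m {}v {}z l vl L IH k].
  have [->|ik] := eqVneq i k; first by rewrite al2.
  have [adjik _|/(al_nadj ik) -> //] := boolP (adj i k).
  by apply: Xsqr; rewrite adj_sym.
have [<-|lk] := eqVneq l k; first by rewrite vdotDl vl al2.
have [adjlk|nadj] := boolP (adj l k); rewrite vdotDl.
  rewrite (al_adj adjlk) => h.
  have ckz : c k z = z by apply: lift_fix L _; lia.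
  rewrite -{1}ckz (c_braid _ (i := k) (j := l)) 1?adj_sym //.
  by rewrite (c_braid _ (i := k)) 1?adj_sym // IH // ckz.
rewrite (al_nadj lk nadj) addr0 => /IH E.
by rewrite -!(c_comm _ lk nadj) E.
Qed.

Lemma lift_refl m v z k : lift m v z -> v != al k ->
  exists m', lift m' (vrefl (al k) v) (c k z).
Proof.
move=> L vk; have v2 := lift_norm L; have k2 := al2 k.
(* Non-negative norms of [v + al k] and [v - al k] confine the pairing to the range from -2 to 2. *)
have := vdot_ge0 (v + al k); have := vdot_ge0 (v - al k).
rewrite !vdotE v2 k2 (vdotC (al k) v) => h1 h2.
have : [\/ vdot v (al k) = -1, vdot v (al k) = 0, vdot v (al k) = 1 |
           vdot v (al k) = 2 \/ vdot v (al k) = -2].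
  move: (vdot v (al k)) h1 h2 => d h1 h2.
  have [->|d1] := eqVneq d (-1); first by constructor 1.
  have [->|d2] := eqVneq d 0; first by constructor 2.
  have [->|d3] := eqVneq d 1; first by constructor 3.
  by constructor 4; lia.
have scale1 : vscale 1 (al k) = al k by apply/ffunP => i; rewrite ffunE mul1r.
have scaleN1 : vscale (-1) (al k) = - al k.
  by apply/ffunP => i; rewrite !ffunE mulN1r.
have scale0 : vscale 0 (al k) = 0 by apply/ffunP => i; rewrite !ffunE mul0r.
rewrite vreflE; case=> [E|E|E|[E|E]]; rewrite ?E ?opprK ?oppr0.
- by exists m.+1; rewrite scale1; apply: lift_up.
- by exists m; rewrite scale0 addr0 (lift_fix L).
- have [m' [z' [_ L' ->]]] := lift_down L E; exists m'.
  by rewrite scaleN1 (lift_sqr L') // vdotDl E vdotNl al2.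
- by rewrite (norm2_eq v2 k2 E) eqxx in vk.
(* Pairing -2 would make [v] the negative of a simple root, against its positive height. *)
- have E' : - v = al k by apply: norm2_eq => //; rewrite !vdotE ?opprK ?E.
  by have := al_rho k; rewrite -E' vdotNl (lift_ht L); lia.
Qed.

End Compatible.

(** The values at the negatives of the simple roots are again compatible, so the results on positive
    roots apply to negative roots after a change of sign. *)
Lemma compatible_opp X : compatible X -> (forall i, c i (c i (X i)) = X i) ->
  compatible (fun i => c i (X i)).
Proof.
case=> Xnadj Xadj Xsqr Xii; split=> i j.
- by move=> ij nadj; rewrite c_comm // Xnadj.
- move=> ij; have ji : adj j i by rewrite adj_sym.
  by rewrite -{1}(Xsqr _ _ ij) c_braid // (Xadj _ _ ij) Xsqr.
- move=> ij; have ji : adj j i by rewrite adj_sym.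
  rewrite -{1}(Xsqr _ _ ij) (c_braid _ ij) (Xadj _ _ ij) (Xsqr _ _ ji).
  by rewrite (c_braid _ ij) (Xadj _ _ ji) Xsqr.
Qed.

Section Full.
Variable X : I -> Z.
Hypothesis compX : compatible X.
Hypothesis Xii : forall i, c i (c i (X i)) = X i.

Definition full_lift (v : vec n) (z : Z) :=
  (exists m, lift X m v z) \/ (exists m, lift (fun i => c i (X i)) m (- v) z).

Lemma full_lift_simple i : full_lift (al i) (X i).
Proof. by left; exists 0%N; apply: lift_simple. Qed.

(** A simple reflection changes the sign of a root only at plus or minus its own simple root. There
    [c k] exchanges the two families of base values, by [Xii] in the return direction. *)
Lemma full_lift_refl v z k :
  full_lift v z -> full_lift (vrefl (al k) v) (c k z).
Proof.
have reflN : vrefl (al k) (al k) = - al k.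
  by apply/ffunP => i; rewrite !ffunE al2; ring.
case=> -[m L].
  have [E|vk] := eqVneq v (al k).
    have [_ ->] := lift_al_inv L E; right; exists 0%N.
    by rewrite E reflN opprK; apply: lift_simple.
  by have [m' L'] := lift_refl compX L vk; left; exists m'.
have [E|vk] := eqVneq (- v) (al k).
  have [_ ->] := lift_al_inv L E; left; exists 0%N.
  by rewrite -[v]opprK E vreflN reflN opprK Xii; apply: lift_simple.
have [m' L'] := lift_refl (compatible_opp compX Xii) L vk.
by right; exists m'; rewrite -vreflN.
Qed.

Lemma full_lift_uniq v z z' : full_lift v z -> full_lift v z' -> z = z'.
Proof.
have disj m m' Y Y' y y' : lift Y m v y -> lift Y' m' (- v) y' -> False.
  by move=> /lift_ht h /lift_ht; rewrite vdotNl h; lia.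
case=> -[m L] [] [m' L'].
- exact: (lift_uniq compX L L').
- by case: (disj _ _ _ _ _ _ L L').
- by case: (disj _ _ _ _ _ _ L' L).
- exact: (lift_uniq (compatible_opp compX Xii) L L').
Qed.

End Full.
End RootLift.

(** * Signed permutations and the simple system of type D *)

Section SignedIndices.
Variable n : nat.
Local Notation sidx := ('I_n * bool)%type.

Definition se (p : sidx) : vec n := vscale (sgb p.2) (eps p.1).

Lemma vdot_epsl (i : 'I_n) (v : vec n) : vdot (eps i) v = v i.
Proof.
rewrite /vdot (bigD1 i) //= big1 => [|k /negbTE ki]; rewrite !ffunE.
  by rewrite eqxx mul1r addr0.
by rewrite ki mul0r.
Qed.

Lemma vdot_sel (p : sidx) (v : vec n) : vdot (se p) v = sgb p.2 * v p.1.
Proof. by rewrite vdotZl vdot_epsl. Qed.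

Lemma vdot_se (p q : sidx) :
  vdot (se p) (se q) = if p.1 == q.1 then sgb p.2 * sgb q.2 else 0.
Proof.
rewrite vdot_sel !ffunE; case: eqP => _; first by rewrite mulr1.
by rewrite !mulr0.
Qed.

Lemma se_neg (i : 'I_n) s : se (i, ~~ s) = - se (i, s).
Proof. by apply/ffunP => k; rewrite !ffunE; case: s => /=; lia. Qed.

Lemma is_rootP (v : vec n) :
  reflect (exists p q, p.1 != q.1 /\ v = se p + se q) (is_root v).
Proof.
apply: (iffP existsP) => [[i /existsP[j /andP[ij /existsP[s /existsP[t /eqP->]]]]]|].
  by exists (i, s), (j, t).
move=> [[i s] [[j t] [ij ->]]]; exists i; apply/existsP; exists j.
by rewrite ij; apply/existsP; exists s; apply/existsP; exists t.
Qed.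

Lemma is_root_se p q : p.1 != q.1 -> is_root (se p + se q).
Proof. by move=> pq; apply/is_rootP; exists p, q. Qed.

Lemma sadj_sym : symmetric (@sadj n).
Proof. by move=> i j; rewrite /sadj; lia. Qed.

End SignedIndices.

Section TypeD.
Variables (n : nat) (hn : (3 <= n)%N).
Local Notation sidx := ('I_n * bool)%type.

Lemma lo_subproof (i : 'I_n) : (i.-1 < n)%N. Proof. by case: i => i /=; lia. Qed.
Lemma hi_subproof (i : 'I_n) : ((if i == 0%N :> nat then 1 else i) < n)%N.
Proof. by case: i => i /= ; case: ifP => _; lia. Qed.

(* Every simple root is [+-eps_lo + eps_hi]; the sign is [+] only at index 0. *)
Definition lo (i : 'I_n) : 'I_n := Ordinal (lo_subproof i).
Definition hi (i : 'I_n) : 'I_n := Ordinal (hi_subproof i).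

Lemma simple_se (i : 'I_n) :
  simple_vec i = se (lo i, i != 0%N :> nat) + se (hi i, false).
Proof.
apply/ffunP => k; rewrite /simple_vec.
have [i0|i0] := eqVneq (i : nat) 0%N; rewrite !ffunE -!val_eqE /= ?i0 /=; last first.
  by rewrite (negbTE i0) mul1r.
by rewrite !mul1r.
Qed.

Lemma lo_neq_hi i : lo i != hi i.
Proof. by rewrite -val_eqE /=; case: i => [[|i] /= _]; lia. Qed.

Lemma simple_root (i : 'I_n) : is_root (simple_vec i).
Proof. by rewrite simple_se is_root_se //= lo_neq_hi. Qed.

Definition srt (i : 'I_n) : droot n := Sub (simple_vec i) (simple_root i).

Ltac dot_simple := rewrite !simple_se !(vdotDl, vdotDr) !vdot_se /= -!val_eqE /=.

Lemma simple_norm (i : 'I_n) : vdot (simple_vec i) (simple_vec i) = 2.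
Proof.
dot_simple; case: i => [[|i] ?] /=; rewrite ?eqxx //.
by do ?[case: eqP => ? /=]; lia.
Qed.

Lemma simple_adj (i j : 'I_n) : sadj i j ->
  vdot (simple_vec i) (simple_vec j) = -1.
Proof.
rewrite /sadj; dot_simple; case: i j => [[|i] ?] [[|j] ?] /=;
  do ?[case: eqP => ? /=]; rewrite /sgb; lia.
Qed.

Lemma simple_nadj (i j : 'I_n) : i != j -> ~~ sadj i j ->
  vdot (simple_vec i) (simple_vec j) = 0.
Proof.
rewrite /sadj -val_eqE; dot_simple; case: i j => [[|i] ?] [[|j] ?] /=;
  do ?[case: eqP => ? /=]; rewrite /sgb; lia.
Qed.

(** Half the sum of the positive roots; pairing with it gives the height. *)
Definition rho : vec n := [ffun k : 'I_n => (k : nat)%:Z].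

Lemma simple_rho (i : 'I_n) : vdot (simple_vec i) rho = 1.
Proof.
by rewrite simple_se vdotDl !vdot_sel !ffunE /=; case: i => [[|i] ?] /=; lia.
Qed.

(** A simple reflection is a transposition of two coordinates; only at index 0, for [eps_1 + eps_2],
    does it also change both signs. *)
Definition sact (i : 'I_n) (p : sidx) : sidx :=
  if p.1 == lo i then (hi i, p.2 (+) (i == 0%N :> nat))
  else if p.1 == hi i then (lo i, p.2 (+) (i == 0%N :> nat)) else p.

Lemma vrefl_se (i : 'I_n) p : vrefl (simple_vec i) (se p) = se (sact i p).
Proof.
rewrite vreflE /sact simple_se !(vdotDl, vdotDr) !vdot_se /=.
have := lo_neq_hi i; case: p => k s /=.
have [-> /negbTE E|kl _] := eqVneq k (lo i).
  rewrite E; apply/ffunP => m; rewrite !ffunE /=.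
  by case: (i == _ :> nat); case: s; rewrite /sgb /=; lia.
have [->|kh] := eqVneq k (hi i); last first.
  by apply/ffunP => m; rewrite !ffunE !addr0 oppr0 mul0r addr0.
apply/ffunP => m; rewrite !ffunE /=.
by case: (i == _ :> nat); case: s; rewrite /sgb /=; lia.
Qed.

Definition sactw (w : word 'I_n) (p : sidx) : sidx :=
  foldr (fun l q => sact l.2 q) p w.

Definition act_vec (w : word 'I_n) (v : vec n) : vec n :=
  foldr (fun l u => vrefl (simple_vec l.2) u) v w.

Lemma act_vecD w u v : act_vec w (u + v) = act_vec w u + act_vec w v.
Proof. by elim: w => //= l w ->; rewrite vreflD. Qed.

Lemma act_vec_inj w : injective (act_vec w).
Proof.
elim: w => // l w IH u v /= /(can_inj (vreflK (simple_norm l.2))).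
exact: IH.
Qed.

Lemma act_vec_se w p : act_vec w (se p) = se (sactw w p).
Proof. by elim: w => //= l w ->; rewrite vrefl_se. Qed.

Lemma sactw_cat w w' p : sactw (w ++ w') p = sactw w (sactw w' p).
Proof. by rewrite /sactw foldr_cat. Qed.

Lemma sact_fst i p : (sact i p).1 = tperm (lo i) (hi i) p.1.
Proof.
rewrite /sact; case: p => k s /=.
case: tpermP => [->|->|/eqP/negbTE -> /eqP/negbTE -> //]; rewrite eqxx //.
by case: eqP => [->|].
Qed.

Lemma sact_idx i p q : ((sact i p).1 == (sact i q).1) = (p.1 == q.1).
Proof. by rewrite !sact_fst (inj_eq perm_inj). Qed.

Lemma sactw_idx w p q : ((sactw w p).1 == (sactw w q).1) = (p.1 == q.1).
Proof. by elim: w => //= l w IH; rewrite sact_idx IH. Qed.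

Lemma sactw_neg w i s :
  sactw w (i, ~~ s) = ((sactw w (i, s)).1, ~~ (sactw w (i, s)).2).
Proof.
elim: w => //= l w ->; case: (sactw w (i, s)) => j t; rewrite /sact /=.
by case: eqP => //= _; [|case: eqP => //= _]; rewrite addNb.
Qed.

Lemma is_root_act w v : is_root v -> is_root (act_vec w v).
Proof.
move=> /is_rootP[p [q [pq ->]]].
by rewrite act_vecD !act_vec_se is_root_se // sactw_idx.
Qed.

Lemma is_root_refl i (v : vec n) : is_root (vrefl (simple_vec i) v) = is_root v.
Proof.
apply/idP/idP; last exact: (@is_root_act [:: gen i]).
by move/(@is_root_act [:: gen i]); rewrite /= vreflK //; apply: simple_norm.
Qed.

Lemma is_root_actE w v : is_root (act_vec w v) = is_root v.
Proof. by elim: w => //= l w IH; rewrite is_root_refl. Qed.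

(** Reflections preserve the roots, so the default of [insubd] is never reached. *)
Lemma val_rrefl i (r : droot n) :
  val (rrefl (simple_vec i) r) = vrefl (simple_vec i) (val r).
Proof. by rewrite /rrefl val_insubd is_root_refl (valP r). Qed.

Lemma act_root_cons l w (r : droot n) :
  act_root (l :: w) r = rrefl (simple_vec l.2) (act_root w r).
Proof. by []. Qed.

Lemma val_act_root w (r : droot n) : val (act_root w r) = act_vec w (val r).
Proof. by elim: w => // l w IH; rewrite act_root_cons val_rrefl IH. Qed.

Lemma act_root_cat w w' (r : droot n) :
  act_root (w ++ w') r = act_root w (act_root w' r).
Proof. by rewrite /act_root foldr_cat. Qed.

Lemma rreflK i : involutive (@rrefl n (simple_vec i)).
Proof.
by move=> r; apply: val_inj; rewrite !val_rrefl vreflK //; apply: simple_norm.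
Qed.

(** The action on roots thus descends from words to the braid group; cancellation of letters holds
    because reflections are involutions. *)
Lemma act_root_peqv w w' : peqv (@Br_rel n) w w' -> act_root w =1 act_root w'.
Proof.
elim=> {w w'} [//|w w' _ IH r|w1 w2 w3 _ IH1 _ IH2 r|u v b g r|u v l1 l2 Rl r].
- by rewrite IH.
- by rewrite IH1 IH2.
- by rewrite !act_root_cat /= rreflK.
rewrite !act_root_cat; congr (act_root u _); move: (act_root v r) => {}r.
apply: val_inj; rewrite !val_act_root; case: Rl => i j /=.
  by move=> ij nadj; rewrite vrefl_comm // simple_nadj.
by move=> adjij; apply: vrefl_braid; rewrite ?simple_norm ?simple_adj.
Qed.

(** * Signed permutations realized by the Weyl group *)

Definition realizable (g : sidx -> sidx) := exists w, sactw w =1 g.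

Lemma realizable_comp f g : realizable f -> realizable g -> realizable (f \o g).
Proof.
by move=> [u fu] [v gv]; exists (u ++ v) => p; rewrite sactw_cat gv fu.
Qed.

Lemma realizable_ext f g : f =1 g -> realizable f -> realizable g.
Proof. by move=> fg [u fu]; exists u => p; rewrite fu. Qed.

Lemma realizable_sact i : realizable (sact i).
Proof. by exists [:: gen i]. Qed.

Definition sswap (i j : 'I_n) (p : sidx) : sidx := (tperm i j p.1, p.2).

Lemma realizable_swap_lo (i : 'I_n) : i != 0%N :> nat -> realizable (sswap (lo i) i).
Proof.
move=> i0; have hi_i : hi i = i by apply: val_inj; rewrite /= (negbTE i0).
apply: realizable_ext (realizable_sact i) => -[k s].
rewrite /sact /sswap hi_i (negbTE i0) /= addbF.
case: tpermP => [->|->|/eqP/negbTE -> /eqP/negbTE -> //]; rewrite eqxx //.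
by case: eqP => [<-|].
Qed.

(** Induction on the distance: the transposition of [i] and [j] is that of [i] and [lo j],
    conjugated by the adjacent transposition of [lo j] and [j]. *)
Lemma realizable_swap i j : realizable (sswap i j).
Proof.
wlog ij : i j / (i < j)%N.
  move=> W; case: (ltngtP i j) => [/W //|/W|/val_inj ->].
    by apply: realizable_ext => p; rewrite /sswap tpermC.
  by exists [::] => p; rewrite /sswap tperm1 perm1; case: p.
have [m Em] : exists m, j = (i + m).+1 :> nat by exists (j - i.+1)%N; lia.
elim: m j Em {ij} => [|m IH] j Em.
  have -> : i = lo j by apply: val_inj; rewrite /= Em addn0.
  by apply: realizable_swap_lo; rewrite Em.
have R1 := @realizable_swap_lo j (ltac:(by rewrite Em)).
have R2 := IH (lo j) (ltac:(by rewrite /= Em addnS)).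
apply: realizable_ext (realizable_comp R1 (realizable_comp R2 R1)) => p /=.
rewrite /sswap /=; congr (_, _); rewrite -!permM.
have -> : tperm i j = (tperm i (lo j) ^ tperm (lo j) j)%g.
  rewrite tpermJ tpermL tpermD //; last by rewrite -val_eqE /= Em; lia.
  by rewrite -val_eqE /= Em; lia.
by rewrite /conjg tpermV mulgA.
Qed.

Definition o0 : 'I_n := Ordinal (leq_trans (isT : (1 <= 3)%N) hn).
Definition o1 : 'I_n := Ordinal (leq_trans (isT : (2 <= 3)%N) hn).
Definition o2 : 'I_n := Ordinal hn.

Definition sflip (j : 'I_n) (p : sidx) : sidx :=
  (p.1, p.2 (+) ((p.1 == o0) || (p.1 == j))).

(** The reflections in [eps_1 + eps_2] and [- eps_1 + eps_2] compose to the sign change of the first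
    two coordinates; conjugation by a transposition gives the other pairs. *)
Lemma realizable_flip j : j != o0 -> realizable (sflip j).
Proof.
move=> j0; have R1 : realizable (sflip o1).
  apply: realizable_ext (realizable_comp (realizable_sact o0) (realizable_sact o1)).
  move=> [k s] /=; rewrite /sact /sflip /= -!val_eqE /=.
  case: (eqVneq (k : nat) 0%N) => [k0|k0] /=.
    by rewrite -?val_eqE /= addbF; congr (_, _); apply: val_inj; rewrite /= k0.
  case: (eqVneq (k : nat) 1%N) => [k1|k1] /=; last first.
    by rewrite (negbTE k0) (negbTE k1) addbF.
  by rewrite addbF; congr (_, _); apply: val_inj; rewrite /= k1.
have R2 := realizable_swap o1 j.
apply: realizable_ext (realizable_comp R2 (realizable_comp R1 R2)) => -[k s] /=.
rewrite /sswap /sflip /= tpermK; congr (_, _ (+) _).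
case: tpermP => [->|->|/eqP k1 /eqP kj].
- by rewrite (negbTE j0) eq_sym.
- by rewrite !eqxx !orbT.
- by rewrite (negbTE k1) (negbTE kj).
Qed.

(** Sign changes come in pairs, so a sign corrected at [o] is compensated at [o0]. This is why the
    sign at [o0] is left uncontrolled. *)
Lemma place (o : 'I_n) (p : sidx) : o != o0 -> p.1 != o0 -> exists u,
  [/\ sactw u p = (o, false), forall b, exists b', sactw u (o0, b) = (o0, b')
    & forall q, q.1 != o0 -> q.1 != o -> q.1 != p.1 -> sactw u q = q].
Proof.
case: p => k s /= oo0 k0.
have [u Eu] : realizable ((if s then sflip o else id) \o sswap k o).
  apply: realizable_comp (realizable_swap _ _).
  by case: s; [apply: realizable_flip | exists [::]].
exists u; split=> [|b|[m b] /= m0 mo mk]; rewrite Eu /sswap /=.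
- by rewrite tpermL; case: s {Eu}; rewrite // /sflip /= eqxx orbT.
- rewrite tpermD //; case: s {Eu} => /=; last by exists b.
  by exists (b (+) true).
- rewrite tpermD 1?eq_sym //; case: s {Eu} => //=.
  by rewrite /sflip /= (negbTE m0) (negbTE mo) addbF.
Qed.

Lemma move2 (p q : sidx) : p.1 != q.1 ->
  exists w b, sactw w p = (o0, b) /\ sactw w q = (o1, false).
Proof.
move=> pq; have [v Ev] := realizable_swap p.1 o0.
have vp : sactw v p = (o0, p.2) by rewrite Ev /sswap tpermL.
have vq : (sactw v q).1 != o0.
  by rewrite -[o0]/((o0, p.2).1) -vp sactw_idx eq_sym.
have [|u [u1 u0 _]] := place (o := o1) _ vq; first by rewrite -val_eqE.
have [b Eb] := u0 p.2.
by exists (u ++ v), b; rewrite !sactw_cat vp.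
Qed.

Lemma move3 (p q r : sidx) : p.1 != q.1 -> p.1 != r.1 -> q.1 != r.1 ->
  exists w b, [/\ sactw w p = (o0, b), sactw w q = (o1, false)
                & sactw w r = (o2, false)].
Proof.
move=> pq pr qr; have [v [b [vp vq]]] := move2 pq.
have r0 : (sactw v r).1 != o0.
  by rewrite -[o0]/((o0, b).1) -vp sactw_idx eq_sym.
have r1 : (sactw v r).1 != o1.
  by rewrite -[o1]/((o1, false).1) -vq sactw_idx eq_sym.
have [|u [u2 u0 uid]] := place (o := o2) _ r0; first by rewrite -val_eqE.
have [b' Eb] := u0 b.
exists (u ++ v), b'; rewrite !sactw_cat vp vq; split=> //.
by rewrite uid // eq_sym.
Qed.

Lemma move4 (p q r s : sidx) (hn4 : (4 <= n)%N) :
  p.1 != q.1 -> p.1 != r.1 -> q.1 != r.1 ->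
  p.1 != s.1 -> q.1 != s.1 -> r.1 != s.1 ->
  exists w b, [/\ sactw w p = (o0, b), sactw w q = (o1, false),
    sactw w r = (o2, false) & sactw w s = (Ordinal hn4, false)].
Proof.
move=> pq pr qr ps qs rs; have [v [b [vp vq vr]]] := move3 pq pr qr.
have s0 : (sactw v s).1 != o0.
  by rewrite -[o0]/((o0, b).1) -vp sactw_idx eq_sym.
have s1 : (sactw v s).1 != o1.
  by rewrite -[o1]/((o1, false).1) -vq sactw_idx eq_sym.
have s2 : (sactw v s).1 != o2.
  by rewrite -[o2]/((o2, false).1) -vr sactw_idx eq_sym.
have [|u [u3 u0 uid]] := place (o := Ordinal hn4) _ s0; first by rewrite -val_eqE.
have [b' Eb] := u0 b.
exists (u ++ v), b'; rewrite !sactw_cat vp vq vr; split=> //.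
  by rewrite uid // eq_sym.
by rewrite uid // eq_sym.
Qed.

Lemma simple_o0 : simple_vec o0 = se (o0, false) + se (o1, false).
Proof.
by rewrite simple_se /=; congr (se (_, _) + se (_, _)); apply: val_inj.
Qed.

Lemma simple_o1 : simple_vec o1 = se (o0, true) + se (o1, false).
Proof.
by rewrite simple_se /=; congr (se (_, _) + se (_, _)); apply: val_inj.
Qed.

Lemma simple_o2 : simple_vec o2 = se (o1, true) + se (o2, false).
Proof.
by rewrite simple_se /=; congr (se (_, _) + se (_, _)); apply: val_inj.
Qed.

Lemma simple_o3 (hn4 : (4 <= n)%N) :
  simple_vec (Ordinal hn4) = se (o2, true) + se (Ordinal hn4, false).
Proof.
by rewrite simple_se /=; congr (se (_, _) + se (_, _)); apply: val_inj.
Qed.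

(** The sign left over at [o0] decides which of the two end nodes of the fork is reached. *)
Definition o01 (b : bool) : 'I_n := if b then o1 else o0.

Lemma simple_o01 b : simple_vec (o01 b) = se (o0, b) + se (o1, false).
Proof. by case: b; rewrite /= ?simple_o0 ?simple_o1. Qed.

Lemma root_conj_simple (r : droot n) : exists w i, act_root w (srt i) = r.
Proof.
have /is_rootP[p [q [pq Er]]] := valP r; have [w [b [wp wq]]] := move2 pq.
exists (winv w), (o01 b).
suff <- : act_root w r = srt (o01 b).
  by rewrite -act_root_cat (act_root_peqv (peqv_mulVw _ w)).
by apply: val_inj; rewrite val_act_root Er act_vecD !act_vec_se wp wq /= simple_o01.
Qed.

End TypeD.

(** * Steinberg relations in the parametrized braid group *)

Section RootPairs.
Variable n : nat.
Local Notation sidx := ('I_n * bool)%type.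

Lemma root_norm (v : vec n) : is_root v -> vdot v v = 2.
Proof.
move=> /is_rootP[[i s] [[j t] [/= /negbTE ij ->]]].
rewrite !(vdotDl, vdotDr) !vdot_se /= !eqxx ij eq_sym ij.
by case: s; case: t.
Qed.

(** Pairs of roots sorted by the number of coordinates shared by their supports: none, one (that of
    [q]), or both. *)
Variant root_pair_spec (u v : vec n) : Prop :=
| RootPairDisjoint (p q r s : sidx) of p.1 != q.1 & r.1 != s.1 &
    p.1 != r.1 & p.1 != s.1 & q.1 != r.1 & q.1 != s.1 &
    u = se p + se q & v = se r + se s
| RootPairOverlap (p q r : sidx) (b : bool) of p.1 != q.1 & p.1 != r.1 &
    q.1 != r.1 & u = se p + se q & v = se (q.1, b) + se r
| RootPairSame (p q : sidx) (b b' : bool) of p.1 != q.1 &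
    u = se p + se q & v = se (p.1, b) + se (q.1, b').

Lemma root_pairP u v : is_root u -> is_root v -> root_pair_spec u v.
Proof.
move=> /is_rootP[[i si] [[j sj] [/= ij ->]]] /is_rootP[[k sk] [[l sl] [/= kl ->]]].
have ji : j != i by rewrite eq_sym.
have [ik|ik] := eqVneq i k.
  subst k; have [jl|jl] := eqVneq j l.
    by subst l; apply: (@RootPairSame _ _ (i, si) (j, sj) sk sl ij erefl erefl).
  rewrite (addrC (se (i, si))).
  exact: (@RootPairOverlap _ _ (j, sj) (i, si) (l, sl) sk ji jl kl erefl erefl).
have [il|il] := eqVneq i l.
  subst l; rewrite (addrC (se (k, sk))).
  have [jk|jk] := eqVneq j k.
    by subst k; apply: (@RootPairSame _ _ (i, si) (j, sj) sl sk ij erefl erefl).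
  rewrite (addrC (se (i, si))).
  exact: (@RootPairOverlap _ _ (j, sj) (i, si) (k, sk) sl ji jk ik erefl erefl).
have [jk|jk] := eqVneq j k.
  subst k.
  exact: (@RootPairOverlap _ _ (i, si) (j, sj) (l, sl) sk ij il kl erefl erefl).
have [jl|jl] := eqVneq j l.
  subst l; rewrite (addrC (se (k, sk))).
  exact: (@RootPairOverlap _ _ (i, si) (j, sj) (k, sk) sl ij ik jk erefl erefl).
exact: (@RootPairDisjoint _ _ (i, si) (j, sj) (k, sk) (l, sl)
  ij kl ik il jk jl erefl erefl).
Qed.

End RootPairs.

Section ParametrizedBraid.
Variables (n : nat) (hn : (3 <= n)%N) (A : comPzRingType).
Variables (H : groupType) (y : 'I_n -> A -> H).
Local Open Scope group_scope.
Hypothesis yA1 : forall i a b,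
  y i a * y i 0%R * y i b = y i 0%R * y i 0%R * y i (a + b)%R.
Hypothesis yC : forall i j a b, i != j -> ~~ sadj i j ->
  y i a * y j b = y j b * y i a.
Hypothesis yA2 : forall i j a b d, sadj i j -> slt i j ->
  y i a * y j b * y i d = y j d * y i (b + a * d)%R * y j a.

(** * Consequences of the relations for simple roots *)

Definition ybr i := y i 0%R.
Definition xbr a i := y i a * (ybr i)^-1.
(** Since [z ^ g] is [g^-1 * z * g], the inverse makes this a left action, matching the order in
    which reflections compose. *)
Definition cbr i z := z ^ (ybr i)^-1.

Lemma xbr0 i : xbr 0%R i = 1. Proof. exact: mulgV. Qed.
Lemma y_xbr i a : y i a = xbr a i * ybr i. Proof. by rewrite mulgVK. Qed.

Lemma ybr_braid i j : sadj i j ->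
  ybr i * ybr j * ybr i = ybr j * ybr i * ybr j.
Proof.
wlog lt : i j / slt i j.
  move=> W ij; have : slt i j || slt j i by move: ij; rewrite /sadj /slt; lia.
  by case/orP=> lt; [apply: W | rewrite [RHS]W // sadj_sym].
by move=> ij; have := yA2 0%R 0%R 0%R ij lt; rewrite mul0r addr0.
Qed.

Lemma cbr_comm i j z : i != j -> ~~ sadj i j -> cbr i (cbr j z) = cbr j (cbr i z).
Proof. by move=> ij nadj; rewrite /cbr -!conjgM -!invgM /ybr yC. Qed.

Lemma cbr_braid i j z : sadj i j ->
  cbr i (cbr j (cbr i z)) = cbr j (cbr i (cbr j z)).
Proof.
by move=> ij; rewrite /cbr -!conjgM -!invgM ?mulgA ybr_braid.
Qed.

Lemma cbr1 i : cbr i 1 = 1. Proof. exact: conj1g. Qed.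

Lemma mul3_conj (x1 x2 x3 g1 g2 g3 : H) : x1 * g1 * (x2 * g2) * (x3 * g3) =
  x1 * x2 ^ g1^-1 * (x3 ^ g2^-1) ^ g1^-1 * (g1 * g2 * g3).
Proof. by rewrite !conjgE !invgK !mulgA !mulgVK. Qed.

(** The braid factors are collected on the right, so that a cubic relation splits into a part in the
    [xbr] and a braid part to be cancelled. *)
Lemma y3E i j k a b d : y i a * y j b * y k d =
  xbr a i * cbr i (xbr b j) * cbr i (cbr j (xbr d k)) * (ybr i * ybr j * ybr k).
Proof.
by rewrite !y_xbr mul3_conj.
Qed.

Lemma xbr_A2 i j a b d : sadj i j -> slt i j ->
  xbr a i * cbr i (xbr b j) * cbr i (cbr j (xbr d i)) =
  xbr d j * cbr j (xbr (b + a * d)%R i) * cbr j (cbr i (xbr a j)).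
Proof.
move=> ij lt; apply: (mulIg (ybr i * ybr j * ybr i)).
by rewrite -y3E (ybr_braid ij) -y3E yA2.
Qed.

Lemma xbr_swap i j b : sadj i j -> cbr i (xbr b j) = cbr j (xbr b i).
Proof.
wlog lt : i j / slt i j.
  move=> W ij; have : slt i j || slt j i by move: ij; rewrite /sadj /slt; lia.
  by case/orP=> lt; [apply: W | rewrite [RHS]W // sadj_sym].
move=> ij; have := xbr_A2 0%R b 0%R ij lt.
by rewrite mulr0 addr0 !xbr0 !cbr1 !mul1g !mulg1.
Qed.

(** The product of the two reflections takes the root [i] to the root [j]. In (A2) only the third
    parameter is kept when [i] precedes [j], only the first when [j] precedes [i]. *)
Lemma xbr_rot i j a : sadj i j -> cbr i (cbr j (xbr a i)) = xbr a j.
Proof.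
have [lt|nlt] := boolP (slt i j) => ij.
  have := xbr_A2 0%R 0%R a ij lt.
  by rewrite mul0r addr0 !xbr0 !cbr1 !mul1g !mulg1.
have lt : slt j i by move: ij nlt; rewrite /sadj /slt; lia.
have ji : sadj j i by rewrite sadj_sym.
have := xbr_A2 a 0%R 0%R ji lt.
by rewrite mulr0 addr0 !xbr0 !cbr1 ?mul1g ?mulg1.
Qed.

Lemma xbr_sqr i j a : sadj i j -> cbr i (cbr i (xbr a j)) = xbr a j.
Proof. by move=> ij; rewrite xbr_swap // xbr_rot. Qed.

(** As [cbr i (xbr b j)] belongs to the sum of the two roots, this is (A2) in Steinberg form: it
    contains both the Chevalley relation ([b = 0]) and the commutation of the sum with each root
    ([d = 0] or [a = 0]). *)
Lemma xbr_prod i j a b d : sadj i j -> slt i j ->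
  xbr a i * cbr i (xbr b j) * xbr d j =
  xbr d j * cbr i (xbr (b + a * d)%R j) * xbr a i.
Proof.
move=> ij lt; have := xbr_A2 a b d ij lt; have ji : sadj j i by rewrite sadj_sym.
by rewrite !xbr_rot // (xbr_swap (b + a * d)%R ij).
Qed.

Lemma xbr_A1 i a b :
  xbr a i * cbr i (cbr i (xbr b i)) = cbr i (cbr i (xbr (a + b)%R i)).
Proof.
apply: (mulIg (ybr i * ybr i * ybr i)).
have := yA1 i a b; rewrite (y3E i i i a) (y3E i i i 0%R 0%R).
by rewrite !xbr0 !cbr1 !mul1g mulg1.
Qed.

(** The case [b = 0] of (A1): the square of [ybr i] centralizes [xbr a i]. Fed back into (A1), this
    leaves additivity. *)
Lemma xbr_ii i a : cbr i (cbr i (xbr a i)) = xbr a i.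
Proof. by have := xbr_A1 i a 0%R; rewrite addr0 xbr0 !cbr1 mulg1. Qed.

Lemma xbrD i a b : xbr a i * xbr b i = xbr (a + b)%R i.
Proof. by have := xbr_A1 i a b; rewrite !xbr_ii. Qed.

Lemma xbr_comm i j a b : i != j -> ~~ sadj i j ->
  commute (xbr a i) (xbr b j).
Proof.
move=> ij nadj; have C d e : commute (y i d) (y j e) by apply: yC.
rewrite /xbr; apply: commuteM; apply: commute_sym; apply: commuteM.
- exact: commute_sym.
- by apply/commuteV/commute_sym; apply: C.
- by apply/commute_sym/commuteV; apply: C.
- by apply/commuteV/commute_sym/commuteV; apply: C.
Qed.

Lemma xbr_compatible a : compatible (@sadj n) cbr (xbr a).
Proof.
split=> i j; last by move=> ij; apply: xbr_sqr.
  move=> ij nadj; apply/conjg_fixP/commgP/commuteV/commute_sym.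
  rewrite /xbr; apply: commuteM; first exact: yC.
  by apply: commuteV; apply: yC.
by move=> ij; apply: xbr_swap.
Qed.

(** * Root elements for all roots and the Steinberg relations *)

Definition xlift a := full_lift (@simple_vec n) cbr (xbr a).

Lemma xlift_refl a v z k :
  xlift a v z -> xlift a (vrefl (simple_vec k) v) (cbr k z).
Proof.
exact: (full_lift_refl (@sadj_sym n) (simple_norm hn) (simple_adj hn)
  (simple_nadj hn) (simple_rho hn) cbr_comm cbr_braid (xbr_compatible a)
  (xbr_ii ^~ a)).
Qed.

Lemma xlift_uniq a v z z' : xlift a v z -> xlift a v z' -> z = z'.
Proof.
exact: (full_lift_uniq (@sadj_sym n) (simple_norm hn) (simple_adj hn)
  (simple_nadj hn) (simple_rho hn) cbr_comm cbr_braid (xbr_compatible a)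
  (xbr_ii ^~ a)).
Qed.

Lemma xlift_exists a (r : droot n) : exists z, xlift a (val r) z.
Proof.
have [w [i <-]] := root_conj_simple hn r; rewrite (val_act_root hn).
elim: w => [|l w [z Lz]] /=; first by exists (xbr a i); apply: full_lift_simple.
by exists (cbr l.2 z); apply: xlift_refl.
Qed.

(** The choice made by [cid] is harmless, the value being unique by [xlift_uniq]. *)
Definition xroot (r : droot n) (a : A) : H := projT1 (cid (xlift_exists a r)).

Lemma xrootP r a : xlift a (val r) (xroot r a).
Proof. exact: projT2 (cid _). Qed.

Lemma xroot_simple i a : xroot (srt hn i) a = xbr a i.
Proof. by apply: xlift_uniq (xrootP _ _) _; apply: full_lift_simple. Qed.

Lemma xroot_refl i r a : xroot (rrefl (simple_vec i) r) a = cbr i (xroot r a).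
Proof.
apply: xlift_uniq (xrootP _ _) _; rewrite (val_rrefl hn).
exact/xlift_refl/xrootP.
Qed.

Lemma xroot_act w r a : xroot (act_root w r) a = xroot r a ^ (eval ybr w)^-1.
Proof.
elim: w => [|[b i] w IH]; first by rewrite invg1 conjg1.
rewrite act_root_cons /= invgM conjgM -IH /eval_letter /= {IH}.
move: (act_root w r) => {}r; case: b => /=; last exact: xroot_refl.
(* For an inverse letter, [r] is written as the double reflection of itself, so that the conjugation
   coming out of [xroot_refl] cancels. *)
by rewrite invgK -[in RHS](rreflK hn i r) [in RHS]xroot_refl /cbr conjgKV.
Qed.

Lemma xrootD r a b : xroot r a * xroot r b = xroot r (a + b)%R.
Proof.
have [w [i <-]] := root_conj_simple hn r.
by rewrite !xroot_act -conjMg !xroot_simple xbrD.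
Qed.

Lemma commute_conj (u v g : H) : commute (u ^ g) (v ^ g) -> commute u v.
Proof. by rewrite /commute -!conjMg => /conjg_inj. Qed.

Lemma xroot_comm_act w r s a b :
  commute (xroot (act_root w r) a) (xroot (act_root w s) b) ->
  commute (xroot r a) (xroot s b).
Proof. by rewrite !xroot_act => /commute_conj. Qed.

Lemma act_root_simple w (r : droot n) p q b :
  val r = se p + se q -> sactw hn w p = (o0 hn, b) ->
  sactw hn w q = (o1 hn, false) -> act_root w r = srt hn (o01 hn b).
Proof.
move=> Er wp wq; apply: val_inj.
by rewrite (val_act_root hn) Er act_vecD !(act_vec_se hn) wp wq /= simple_o01.
Qed.

Lemma o01_adj b : sadj (o01 hn b) (o2 hn). Proof. by case: b. Qed.
Lemma o01_lt b : slt (o01 hn b) (o2 hn). Proof. by case: b. Qed.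

Lemma xroot_o012 b d :
  xroot (rrefl (simple_vec (o2 hn)) (srt hn (o01 hn b))) d =
  cbr (o01 hn b) (xbr d (o2 hn)).
Proof. by rewrite xroot_refl xroot_simple xbr_swap // sadj_sym o01_adj. Qed.

Lemma simple_o012 b : vrefl (simple_vec (o2 hn)) (simple_vec (o01 hn b)) =
  simple_vec (o01 hn b) + simple_vec (o2 hn).
Proof.
rewrite vreflE (simple_adj hn (o01_adj b)) opprK; congr (_ + _).
by apply/ffunP => k; rewrite ffunE mul1r.
Qed.

Lemma neq_negb (b d : bool) : b != ~~ d -> b = d.
Proof. by case: b; case: d. Qed.

(** The pair is conjugated to two orthogonal simple roots, or to a simple root and a sum of two
    adjacent ones, unless the two roots coincide. *)
Lemma xroot_comm (r s : droot n) a b :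
  ~~ is_root (val r + val s)%R -> (val r + val s != 0)%R ->
  commute (xroot r a) (xroot s b).
Proof.
case: (root_pairP (valP r) (valP s)).
- move=> p q p' q' pq p'q' pp' pq' qp' qq' Er Es _ _.
  have hn4 : (4 <= n)%N.
    move: pq p'q' pp' pq' qp' qq'; rewrite -!val_eqE /=.
    have := (ltn_ord p.1, ltn_ord q.1, ltn_ord p'.1, ltn_ord q'.1).
    by move=> [[[]]]; lia.
  (* The sign of [p'] is reversed beforehand because the target [simple_o3] has a minus sign at
     [o2]. *)
  have [w [d [wp wq wp' wq']]] := @move4 n hn p q (p'.1, ~~ p'.2) q' hn4
    pq pp' qp' pq' qq' p'q'.
  apply: (@xroot_comm_act w); rewrite (act_root_simple Er wp wq).
  have -> : act_root w s = srt hn (Ordinal hn4).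
    apply: val_inj; rewrite (val_act_root hn) Es act_vecD !(act_vec_se hn) /=.
    have := sactw_neg hn w p'.1 (~~ p'.2).
    rewrite wp' negbK -surjective_pairing => ->.
    by rewrite wq' simple_o3.
  by rewrite !xroot_simple; apply: xbr_comm; case: (d).
- move=> p q q' d pq pq' qq' Er Es.
  have [Ed|dq] := eqVneq d (~~ q.2).
    by rewrite Er Es Ed se_neg -surjective_pairing addrA addrK is_root_se.
  have {dq} Es : val s = (se q + se q')%R.
    by rewrite Es (neq_negb dq) -surjective_pairing.
  move=> _ _; rewrite eq_sym in pq.
  (* The shared coordinate goes to [o0], with the same sign [e] in both roots; [s] then becomes the
     sum of the simple roots [o01 e] and [o2], and [r] the first of them. *)
  have [w [e [wq wp wq']]] := move3 hn pq qq' pq'.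
  apply: (@xroot_comm_act w); rewrite addrC in Er.
  rewrite (act_root_simple Er wq wp).
  have -> : act_root w s = rrefl (simple_vec (o2 hn)) (srt hn (o01 hn e)).
    apply: val_inj; rewrite (val_act_root hn) Es act_vecD !(act_vec_se hn).
    rewrite wq wq' (val_rrefl hn) /= simple_o012 simple_o01 simple_o2 -addrA.
    by congr (_ + _)%R; rewrite addrA -[true]/(~~ false) se_neg subrr add0r.
  rewrite xroot_o012 xroot_simple; set i := o01 hn e.
  have := xbr_prod a b 0%R (o01_adj e) (o01_lt e).
  by rewrite mulr0 addr0 xbr0 mulg1 mul1g.
- move=> p q d e pq Er Es.
  have [Ed|dp] := eqVneq d (~~ p.2); have [Ee|eq] := eqVneq e (~~ q.2).
  + rewrite Er Es Ed Ee !se_neg -!surjective_pairing addrACA !subrr addr0.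
    by rewrite eqxx.
  + move=> _ _; have [w [x [wp wq]]] := move2 hn pq.
    apply: (@xroot_comm_act w); rewrite (act_root_simple Er wp wq).
    have -> : act_root w s = srt hn (o01 hn (~~ x)).
      apply: (act_root_simple Es).
        by rewrite Ed sactw_neg -surjective_pairing wp.
      by rewrite (neq_negb eq) -surjective_pairing.
    by rewrite !xroot_simple; apply: xbr_comm; case: (x).
  (* The coordinate where the signs differ must land on [o0], the only place with a free sign, so
     [p] and [q] exchange roles. *)
  + move=> _ _; rewrite eq_sym in pq; have [w [x [wq wp]]] := move2 hn pq.
    rewrite addrC in Er; rewrite addrC in Es.
    apply: (@xroot_comm_act w); rewrite (act_root_simple Er wq wp).
    have -> : act_root w s = srt hn (o01 hn (~~ x)).
      apply: (act_root_simple Es).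
        by rewrite Ee sactw_neg -surjective_pairing wq.
      by rewrite (neq_negb dp) -surjective_pairing.
    by rewrite !xroot_simple; apply: xbr_comm; case: (x).
  + have -> : s = r.
      apply: val_inj.
      by rewrite Er Es (neq_negb dp) (neq_negb eq) -!surjective_pairing.
    by move=> _ _; rewrite /commute !xrootD addrC.
Qed.

(** Comparing norms gives pairing -1, which leaves only one shared coordinate with opposite signs.
    Such a pair is conjugate to the simple roots [o01 x] and [o2], where [xbr_prod] applies. *)
Lemma xroot_chev (r s t : droot n) a b : (val t = val r + val s)%R ->
  xroot r a * xroot s b = xroot s b * xroot t (a * b)%R * xroot r a.
Proof.
move=> Et; have rs : vdot (val r) (val s) = (-1)%R.
  have := root_norm (valP t); rewrite Et !(vdotDl, vdotDr) !root_norm ?valP //.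
  by rewrite (vdotC (val s)); lia.
case: (root_pairP (valP r) (valP s)).
- move=> p q p' q' _ _ pp' pq' qp' qq' Er Es; move: rs; rewrite Er Es.
  rewrite !(vdotDl, vdotDr) !vdot_se.
  by rewrite (negbTE pp') (negbTE pq') (negbTE qp') (negbTE qq').
- move=> p q q' d pq pq' qq' Er Es.
  have Ed : d = ~~ q.2.
    move: rs; rewrite Er Es !(vdotDl, vdotDr) !vdot_se /= eqxx.
    rewrite (negbTE pq) (negbTE pq') (negbTE qq') !add0r addr0.
    by case: (q.2); case: d {Es}.
  have [w [x [wp wq wq']]] := move3 hn pq pq' qq'.
  have Wr := act_root_simple Er wp wq.
  have Ws : act_root w s = srt hn (o2 hn).
    apply: val_inj; rewrite (val_act_root hn) Es act_vecD !(act_vec_se hn).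
    by rewrite Ed sactw_neg -surjective_pairing wq wq' /= simple_o2.
  have Wt : act_root w t = rrefl (simple_vec (o2 hn)) (srt hn (o01 hn x)).
    apply: val_inj; rewrite (val_act_root hn) Et act_vecD -!(val_act_root hn).
    by rewrite Wr Ws (val_rrefl hn) /= simple_o012.
  apply: (@conjg_inj _ (eval ybr w)^-1).
  rewrite !conjMg -!xroot_act Wr Ws Wt xroot_o012 !xroot_simple.
  have := xbr_prod a 0%R b (o01_adj x) (o01_lt x).
  by rewrite xbr0 cbr1 mulg1 add0r.
- move=> p q d e /negbTE pq Er Es; move: rs; rewrite Er Es.
  rewrite !(vdotDl, vdotDr) !vdot_se /= !eqxx pq eq_sym pq.
  by case: (p.2); case: (q.2); case: d {Es}; case: e.
Qed.

(** * The map back from the semidirect product *)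

Definition psi (p : word (droot n * A) * word 'I_n) : H :=
  eval (fun g => xroot g.1 g.2) p.1 * eval ybr p.2.

Lemma eval_act_st w (s : word (droot n * A)) :
  eval (fun g => xroot g.1 g.2) (act_st w s) =
  eval (fun g => xroot g.1 g.2) s ^ (eval ybr w)^-1.
Proof.
elim: s => [|[b [r a]] s IH] /=; first by rewrite conj1g.
rewrite conjMg -IH /eval_letter /= xroot_act; case: b => //=.
by rewrite conjVg.
Qed.

(** Multiplicativity holds because the action on root elements is conjugation by the braid part, by
    [eval_act_st]. *)
Lemma psi_mul p q : psi (sd_mul p q) = psi p * psi q.
Proof.
rewrite /psi !eval_cat eval_act_st conjgE invgK -!mulgA; congr (_ * _).
by rewrite mulKg.
Qed.

Lemma psi_inv p : psi (sd_inv p) = (psi p)^-1.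
Proof.
by rewrite /psi eval_act_st !eval_winv invgK invgM conjgE -!mulgA mulgV mulg1.
Qed.

Lemma phi_genE i (a : A) : phi_gen i a = ([:: gen (srt hn i, a)], [:: gen i]).
Proof. by rewrite /phi_gen (insubT _ (simple_root hn i)). Qed.

Lemma psi_phi w : psi (phi w) = eval (fun g => y g.1 g.2) w.
Proof.
have psi_gen i a : psi (phi_gen i a) = y i a.
  by rewrite phi_genE /psi /= /eval_letter /= !mulg1 xroot_simple -y_xbr.
elim: w => [|[b [i a]] w IH] /=; first by rewrite /psi mulg1.
rewrite psi_mul IH; congr (_ * _); rewrite /eval_letter /=.
by case: b => /=; rewrite /phi_letter /= ?psi_inv psi_gen.
Qed.

Lemma psi_peqv p q : peqv (@St_rel n A) p.1 q.1 -> peqv (@Br_rel n) p.2 q.2 ->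
  psi p = psi q.
Proof.
move=> pq1 pq2; rewrite /psi; congr (_ * _).
  apply: eval_peqv pq1 => l1 l2 [r a b|r s a b nrs rs0|r s t a b Et] /=;
    rewrite /eval_letter /= !mulg1.
  - exact: xrootD.
  - exact: xroot_comm.
  - by rewrite mulgA; apply: xroot_chev.
apply: eval_peqv pq2 => l1 l2 [i j ij nadj|i j ij] /=;
  rewrite /eval_letter /= !mulg1; first exact: yC.
by rewrite !mulgA ybr_braid.
Qed.

End ParametrizedBraid.

(** * The semidirect product *)

Section SemidirectProduct.
Variables (n : nat) (hn : (3 <= n)%N) (A : comPzRingType).
Local Notation SD := (word (droot n * A) * word 'I_n)%type.
Implicit Types (p q : SD) (r : droot n) (a b : A).
Implicit Types (w : word 'I_n) (s : word (droot n * A)).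

Definition sd_eqv p q :=
  peqv (@St_rel n A) p.1 q.1 /\ peqv (@Br_rel n) p.2 q.2.

Lemma sd_eqv_refl p : sd_eqv p p.
Proof. by split; apply: peqv_refl. Qed.

Lemma sd_eqv_sym p q : sd_eqv p q -> sd_eqv q p.
Proof. by case=> *; split; apply: peqv_sym. Qed.

Lemma sd_eqv_trans q p (t : SD) : sd_eqv p q -> sd_eqv q t -> sd_eqv p t.
Proof. by move=> [h1 h2] [h3 h4]; split; apply: peqv_trans; eassumption. Qed.

Lemma act_st_cat w s s' : act_st w (s ++ s') = act_st w s ++ act_st w s'.
Proof. exact: map_cat. Qed.

Lemma act_st_catl w w' s : act_st (w ++ w') s = act_st w (act_st w' s).
Proof.
rewrite /act_st -map_comp; apply: eq_map => -[b [r a]] /=.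
by rewrite act_root_cat.
Qed.

Lemma act_st_peqvl w w' s :
  peqv (@Br_rel n) w w' -> act_st w s = act_st w' s.
Proof.
by move=> /(act_root_peqv hn) E; apply: eq_map => -[b [r a]]; rewrite /= E.
Qed.

Lemma act_st_nil s : act_st [::] s = s.
Proof. by rewrite /act_st -[RHS]map_id; apply: eq_map => -[b [r a]]. Qed.

(** The action on vectors is additive, injective and preserves the roots, so it carries each
    Steinberg relation to one of the same type. *)
Lemma act_st_peqv w s s' :
  peqv (@St_rel n A) s s' -> peqv (@St_rel n A) (act_st w s) (act_st w s').
Proof.
have act0 : act_vec w 0 = 0.
  by apply: (addrI (act_vec w 0)); rewrite -act_vecD !addr0.
elim=> {s s'} [s|s s' _ /peqv_sym //|s1 s2 s3 _ h1 _ h2|u v b g|u v l1 l2 Rl].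
- exact: peqv_refl.
- exact: peqv_trans h1 h2.
- by rewrite !act_st_cat; apply: peqv_cancel.
rewrite !act_st_cat; apply: peqv_rel.
case: Rl => [r a b|r t a b nrt rt0|r t k a b E]; first exact: St_add.
  apply: St_comm; rewrite !(val_act_root hn) vaddE -act_vecD ?is_root_actE //.
  by rewrite vzeroE -act0 (inj_eq (@act_vec_inj n hn w)).
by apply: St_chev; rewrite !(val_act_root hn) E vaddE act_vecD.
Qed.

Lemma sd_mul_eqv p p' q q' :
  sd_eqv p p' -> sd_eqv q q' -> sd_eqv (sd_mul p q) (sd_mul p' q').
Proof.
move=> [p1 p2] [q1 q2]; split; apply: peqv_cat => //.
by rewrite -(act_st_peqvl _ p2); apply: act_st_peqv.
Qed.

Lemma sd_mulA p q (t : SD) : sd_mul p (sd_mul q t) = sd_mul (sd_mul p q) t.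
Proof. by rewrite /sd_mul /= act_st_cat act_st_catl !catA. Qed.

Lemma sd_mul1 p : sd_mul ([::], [::]) p = p.
Proof. by case: p => s w; rewrite /sd_mul /= act_st_nil. Qed.

Lemma phi_cat (u v : word ('I_n * A)) : phi (u ++ v) = sd_mul (phi u) (phi v).
Proof. by elim: u => [|l u IH] /=; rewrite ?sd_mul1 // IH sd_mulA. Qed.

Lemma sd_mulV p : sd_eqv (sd_mul p (sd_inv p)) ([::], [::]).
Proof.
case: p => s w; rewrite /sd_mul /sd_inv; split=> /=; last exact: peqv_mulwV.
rewrite -act_st_catl (act_st_peqvl _ (peqv_mulwV _ w)) act_st_nil.
exact: peqv_mulwV.
Qed.

Lemma sd_mulVl p : sd_eqv (sd_mul (sd_inv p) p) ([::], [::]).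
Proof.
case: p => s w; rewrite /sd_mul /sd_inv; split=> /=; last exact: peqv_mulVw.
by rewrite -act_st_cat; apply: (act_st_peqv _ (peqv_mulVw _ s)).
Qed.

Local Notation xs r a := (pgen (@St_rel n A) (r, a)).
Local Open Scope group_scope.

Lemma stD r a b : xs r a * xs r b = xs r (a + b)%R.
Proof. by have := cls_rel (St_add r a b); rewrite !cls_cons cls_nil !mulg1. Qed.

Lemma st0 r : xs r 0%R = 1.
Proof. by apply: (@mulgI _ (xs r 0%R)); rewrite stD addr0 mulg1. Qed.

(** With a non-negative pairing the sum has norm at least 4, so it is neither a root nor zero. *)
Lemma st_comm (r t : droot n) a b : (0 <= vdot (val r) (val t))%R ->
  xs r a * xs t b = xs t b * xs r a.
Proof.
move=> rt; have norm : (2 < vdot (val r + val t) (val r + val t))%R.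
  by rewrite !(vdotDl, vdotDr) !root_norm ?valP // (vdotC (val t)); lia.
have nroot : ~~ is_root (vadd (val r) (val t)).
  by apply/negP => /root_norm E; move: norm; rewrite E.
have nz : vadd (val r) (val t) != vzero n.
  apply/eqP => E; move: norm; rewrite vaddE in E.
  by rewrite E /vdot big1 // => k _; rewrite ffunE mul0r.
by have := cls_rel (St_comm a b nroot nz); rewrite !cls_cons cls_nil !mulg1.
Qed.

Lemma st_chev (r t k : droot n) a b : (val k = val r + val t)%R ->
  xs r a * xs t b = xs t b * (xs k (a * b)%R * xs r a).
Proof.
by move=> E; have := cls_rel (St_chev a b E); rewrite !cls_cons cls_nil !mulg1.
Qed.

Lemma rrefl_orth i j : i != j -> ~~ sadj i j ->
  rrefl (simple_vec i) (srt hn j) = srt hn j.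
Proof.
move=> ij nadj; apply: val_inj; rewrite (val_rrefl hn) /= vreflE vdotC.
by rewrite simple_nadj //; apply/ffunP => k; rewrite !ffunE oppr0 mul0r addr0.
Qed.

Lemma vrefl_adj (i j : 'I_n) : sadj i j ->
  (vrefl (simple_vec i) (simple_vec j) = simple_vec i + simple_vec j)%R.
Proof.
move=> ij; rewrite vreflE vdotC simple_adj // opprK addrC; congr (_ + _)%R.
by apply/ffunP => k; rewrite ffunE mul1r.
Qed.

(** The inner reflection gives [alpha_i + alpha_j], which is also the reflection of [alpha_j] in
    [alpha_i]; the outer one undoes the latter. *)
Lemma rrefl_rot i j : sadj i j ->
  rrefl (simple_vec i) (rrefl (simple_vec j) (srt hn i)) = srt hn j.
Proof.
move=> ij; apply: val_inj; rewrite !(val_rrefl hn) /=.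
rewrite vrefl_adj 1?sadj_sym // addrC -(vrefl_adj ij) vreflK //.
exact: simple_norm.
Qed.

Lemma phi_rel l1 l2 : @BrA_rel n A l1 l2 -> sd_eqv (phi l1) (phi l2).
Proof.
case=> [i a b|i j a b ij nadj|i j a b d ij lt];
  rewrite /phi /= /phi_letter /= !(phi_genE hn) /sd_mul /=; split=> /=.
- apply/clsP; rewrite !cls_cons /= !mulg1 (rreflK hn) !st0 !mul1g.
  exact: stD.
- exact: peqv_refl.
- apply/clsP; rewrite !cls_cons /= !mulg1 !rrefl_orth // 1?eq_sym 1?sadj_sym //.
  by apply: st_comm; rewrite /= simple_nadj.
- by have := peqv_rel [::] [::] (Br_comm ij nadj).
- have ji : sadj j i by rewrite sadj_sym.
  apply/clsP; rewrite !cls_cons /= !mulg1 !rrefl_rot //.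
  have <- : rrefl (simple_vec i) (srt hn j) = rrefl (simple_vec j) (srt hn i).
    by apply: val_inj; rewrite !(val_rrefl hn) /= !vrefl_adj // addrC.
  set t := rrefl _ _.
  have Et : (val t = val (srt hn i) + val (srt hn j))%R.
    by rewrite (val_rrefl hn) /= vrefl_adj.
  have tj : (0 <= vdot (val t) (val (srt hn j)))%R.
    by rewrite Et vdotDl /= simple_norm // simple_adj.
  have ti : (0 <= vdot (val t) (val (srt hn i)))%R.
    by rewrite Et vdotDl /= simple_norm // simple_adj.
  (* The [t] factor is moved past [j], the Chevalley relation exchanges [i] and [j] and creates
     parameter [a * d] at [t], and the two [t] factors merge into [b + a * d]. *)
  rewrite (st_comm _ _ tj) mulgA (st_chev _ _ Et) -!mulgA; congr (_ * _).
  by rewrite -(st_comm _ _ ti) mulgA stD addrC.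
- by have := peqv_rel [::] [::] (Br_braid ij).
Qed.

Lemma phi_peqv u v : peqv (@BrA_rel n A) u v -> sd_eqv (phi u) (phi v).
Proof.
elim=> {u v} [u|u v _ /sd_eqv_sym //|u v w _ uv _ vw|u v b g|u v l1 l2 Rl].
- exact: sd_eqv_refl.
- exact: sd_eqv_trans uv vw.
- rewrite -[_ :: _ :: v]/([:: (b, g); (~~ b, g)] ++ v) !phi_cat.
  apply: sd_mul_eqv; first exact: sd_eqv_refl.
  rewrite -[X in sd_eqv _ X]sd_mul1; apply: sd_mul_eqv; last exact: sd_eqv_refl.
  rewrite /phi /= sd_mulA.
  apply: (sd_eqv_trans (q := sd_mul ([::], [::]) ([::], [::]))).
    apply: sd_mul_eqv; last exact: sd_eqv_refl.
    by case: b; rewrite /phi_letter /=; [apply: sd_mulVl | apply: sd_mulV].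
  by rewrite sd_mul1; apply: sd_eqv_refl.
- rewrite !phi_cat; apply: sd_mul_eqv; first exact: sd_eqv_refl.
  by apply: sd_mul_eqv; [apply: phi_rel | apply: sd_eqv_refl].
Qed.

(** * Surjectivity and injectivity *)

Definition lift0 (w : word 'I_n) : word ('I_n * A) :=
  map (fun l => (l.1, (l.2, 0%R))) w.

Lemma phi_lift0 w : sd_eqv (phi (lift0 w)) ([::], w).
Proof.
elim: w => [|[b i] w IH] /=; first exact: sd_eqv_refl.
apply: (sd_eqv_trans (q := sd_mul ([::], [:: (b, i)]) ([::], w))); last first.
  exact: sd_eqv_refl.
apply: sd_mul_eqv IH; rewrite /phi_letter /= !(phi_genE hn).
by case: b; split=> /=; try exact: peqv_refl; apply/clsP;
  rewrite cls_cons /= st0 ?invg1 mulg1.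
Qed.

Lemma phi_root r a : exists u, sd_eqv ([:: gen (r, a)], [::]) (phi u).
Proof.
have [w [i <-]] := root_conj_simple hn r.
(* The middle word [y_i^a (y_i^0)^-1] maps to the root element of [alpha_i] alone; conjugation by
   the parameter-zero lift of [w] moves it to the required root. *)
exists (lift0 w ++ [:: gen (i, a); (true, (i, 0%R))] ++ lift0 (winv w)).
rewrite !phi_cat; apply: sd_eqv_sym.
have Ei : sd_eqv (phi [:: gen (i, a); (true, (i, 0%R))])
                 ([:: gen (srt hn i, a)], [::]).
  rewrite -cat1s phi_cat.
  apply: (sd_eqv_trans (sd_mul_eqv (sd_eqv_refl _) (phi_lift0 [:: (true, i)]))).
  rewrite /phi /= /phi_letter /= (phi_genE hn) /sd_mul /=.
  by split=> /=; [apply: peqv_refl | apply: (peqv_cancel _ [::] [::])].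
apply: (sd_eqv_trans (sd_mul_eqv (phi_lift0 w)
  (sd_mul_eqv Ei (phi_lift0 (winv w))))).
by rewrite /sd_mul /=; split=> /=; [apply: peqv_refl | apply: peqv_mulwV].
Qed.

Lemma phi_surj s w : exists u, sd_eqv (s, w) (phi u).
Proof.
have [u Eu] : exists u, sd_eqv (s, [::]) (phi u).
  elim: s => [|[b [r a]] s [u Eu]]; first by exists [::]; apply: sd_eqv_refl.
  (* An inverse letter is the root element with parameter [- a]. *)
  have [v Ev] := phi_root r (if b then - a else a)%R.
  exists (v ++ u); rewrite phi_cat.
  apply: sd_eqv_trans (sd_mul_eqv Ev Eu); rewrite /sd_mul /= act_st_nil.
  split=> /=; last exact: peqv_refl.
  apply/clsP; rewrite !cls_cons /=; congr (_ * _); case: b {Ev} => //.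
  by apply/mulg1_eq; rewrite stD subrr st0.
exists (u ++ lift0 w); rewrite phi_cat.
apply: sd_eqv_trans (sd_mul_eqv Eu (sd_eqv_sym (phi_lift0 w))).
by rewrite /sd_mul /= cats0; apply: sd_eqv_refl.
Qed.

(** The preceding construction is applied with [Br(D_n,A)] itself as target and its own generators
    as [y]; then [psi] after [phi] returns the class of a word. *)
Lemma phi_inj u v : sd_eqv (phi u) (phi v) -> peqv (@BrA_rel n A) u v.
Proof.
pose y (i : 'I_n) a := pgen (@BrA_rel n A) (i, a).
have yA1 i a b : y i a * y i 0%R * y i b = y i 0%R * y i 0%R * y i (a + b)%R.
  have := cls_rel (BrA_A1 i a b).
  by rewrite !cls_cons cls_nil !mulg1 -!mulgA.
have yC i j a b : i != j -> ~~ sadj i j -> y i a * y j b = y j b * y i a.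
  move=> ij nadj; have := cls_rel (BrA_A1A1 a b ij nadj).
  by rewrite !cls_cons cls_nil !mulg1.
have yA2 i j a b d : sadj i j -> slt i j ->
    y i a * y j b * y i d = y j d * y i (b + a * d)%R * y j a.
  move=> ij lt; have := cls_rel (BrA_A2 a b d ij lt).
  by rewrite !cls_cons cls_nil !mulg1 -!mulgA.
move=> [E1 E2]; apply/clsP; rewrite -!eval_pgen.
have evalE (t : word ('I_n * A)) : eval (pgen (@BrA_rel n A)) t =
    psi hn yA1 yC yA2 (phi t).
  by rewrite psi_phi; elim: t => //= -[b [i a]] t ->.
by rewrite !evalE; apply: psi_peqv.
Qed.

End SemidirectProduct.

(* phi is well defined and injective on Br(D_n,A) (first conjunct, both
   directions of the iff) and surjective onto St(D_n,A) x| Br(D_n);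
   the semidirect product equality is componentwise. *)
Theorem theorem3p5 (n : nat) (A : comPzRingType) (hn : (3 <= n)%N) :
  (forall w1 w2 : word ('I_n * A),
     peqv (@BrA_rel n A) w1 w2 <->
     (peqv (@St_rel n A) (phi w1).1 (phi w2).1 /\
      peqv (@Br_rel n) (phi w1).2 (phi w2).2)) /\
  (forall (s : word (droot n * A)) (b : word 'I_n),
     exists w : word ('I_n * A),
       peqv (@St_rel n A) s (phi w).1 /\ peqv (@Br_rel n) b (phi w).2).
Proof.
split=> [w1 w2|s b]; last exact: phi_surj.
by split=> [/(phi_peqv hn)|/(phi_inj hn)].
Qed.
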